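(* Let $m,n\geq 1$ be integers. Then $\mathrm{QEC}(S_{m+1,n+1})=-2+2t$, where $t$ is the largest real root of the polynomial $$(m+n+2)t^3-(m+n+1-mn)t^2-2mn\,t+mn.$$
   Context: For a finite, simple, connected, unweighted graph $G=(V,E)$, the distance matrix $D_G$ is the real symmetric $V\times V$ matrix whose $(v,w)$ entry is the length of a shortest path joining $v$ and $w$ (and $0$ if $v=w$). Let $C(V)$ be the space of real-valued functions on $V$, with canonical inner product $\langle\cdot,\cdot\rangle$, and let $e\in C(V)$ be the constant function $1$. For a graph $G$ with at least two vertices, the quadratic embedding constant is $$\mathrm{QEC}(G)=\max\{\langle f,D_Gf\rangle : f\in C(V),\ \langle f,f\rangle=1,\ \langle e,f\rangle=0\}.$$ The double star graph $S_{m+1,n+1}$ is the tree on $m+n+2$ vertices obtained by adding an edge between the center vertices of the star graphs $K_{1,m}$ and $K_{1,n}$ (taken on disjoint vertex sets; for $K_{1,1}$ either vertex may be designated as the center). *)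

(* Defs.v *)
From HB Require Import structures.
From mathcomp Require Import all_boot all_order all_algebra.
From mathcomp Require Import boolp classical_sets reals.

Set Implicit Arguments.
Unset Strict Implicit.
Unset Printing Implicit Defensive.

Import Order.TTheory GRing.Theory Num.Theory.
Local Open Scope ring_scope.
Local Open Scope classical_set_scope.

Record cgraph := CGraph {
  vertex :> finType;
  adj : rel vertex;
  adj_sym : symmetric adj;
  adj_irrefl : irreflexive adj;
  adj_connected : forall v w, connect adj v w }.

Definition joined_by_path (G : cgraph) (v w : G) (k : nat) : bool :=
  [exists p : k.-tuple G,
    [&& path (@adj G) v p, last v p == w & uniq (v :: p)]].

Lemma joined_by_path_ex (G : cgraph) (v w : G) :
  exists k, joined_by_path v w k.
Proof.
have /connectP[p ep ->] := adj_connected v w.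
case/shortenP: ep => q eq uq _.
by exists (size q); apply/existsP; exists (in_tuple q); rewrite eq eqxx.
Qed.

Definition dist (G : cgraph) (v w : G) : nat := ex_minn (joined_by_path_ex v w).

Definition dist_mx (R : realType) (G : cgraph) (v w : G) : R := (dist v w)%:R.

Definition inner (R : realType) (V : finType) (f g : V -> R) : R :=
  \sum_v f v * g v.

Definition mx_app (R : realType) (V : finType) (A : V -> V -> R) (f : V -> R)
    : V -> R :=
  fun v => \sum_w A v w * f w.

Definition is_max (R : realType) (A : set R) (q : R) : Prop :=
  A q /\ ubound A q.

(* [is_QEC G q] reads "the maximum defining QEC(G) exists and equals q"; such a
   q is unique, and there is none when G has fewer than two vertices. *)
Definition is_QEC (R : realType) (G : cgraph) (q : R) : Prop :=
  is_max [set inner f (mx_app (@dist_mx R G) f) |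
           f in [set f : G -> R | inner f f = 1 /\ inner (fun=> 1) f = 0]] q.

(* The star K_{1,m}, with center ord0 *)
Definition star_adj (m : nat) : rel 'I_m.+1 :=
  fun i j => (i == ord0) != (j == ord0).

Definition double_star_adj (m n : nat) : rel ('I_m.+1 + 'I_n.+1) :=
  fun x y => match x, y with
  | inl i, inl j => star_adj i j
  | inr i, inr j => star_adj i j
  | inl i, inr j => (i == ord0) && (j == ord0)
  | inr i, inl j => (i == ord0) && (j == ord0)
  end.

Lemma double_star_sym m n : symmetric (@double_star_adj m n).
Proof.
by move=> [i|i] [j|j] //=; rewrite /star_adj 1?eq_sym // andbC.
Qed.

Lemma double_star_irrefl m n : irreflexive (@double_star_adj m n).
Proof. by move=> [i|i]; rewrite /= /star_adj eqxx. Qed.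

Lemma double_star_connected m n x y : connect (@double_star_adj m n) x y.
Proof.
have sym := sym_connect_sym (@double_star_sym m n).
suff center z : connect (@double_star_adj m n) (inl ord0) z.
  by apply: connect_trans (center y); rewrite sym.
case: z => i; have [->|i0] := eqVneq i ord0.
- exact: connect0.
- by apply: connect1; rewrite /= /star_adj eqxx (negPf i0).
- exact: connect1.
- apply: (@connect_trans _ _ (inr ord0)); exact: connect1.
Qed.

(* The tree S_{m+1,n+1} on m + n + 2 vertices *)
Definition double_star (m n : nat) : cgraph :=
  CGraph (@double_star_sym m n) (@double_star_irrefl m n)
         (@double_star_connected m n).

Definition double_star_poly (R : realType) (m n : nat) : {poly R} :=
  (m%:R + n%:R + 2) *: 'X^3 - (m%:R + n%:R + 1 - m%:R * n%:R) *: 'X^2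
    - (2 * m%:R * n%:R) *: 'X + (m%:R * n%:R)%:P.

Definition is_largest_root (R : realType) (p : {poly R}) (t : R) : Prop :=
  root p t /\ forall s, root p s -> s <= t.

(* Main.v *)
Require Import Defs.
From mathcomp Require Import all_boot all_order all_algebra.
From mathcomp Require Import boolp classical_sets reals.
From mathcomp Require Import ring lra.

Set Implicit Arguments.
Unset Strict Implicit.
Unset Printing Implicit Defensive.

Import Order.TTheory GRing.Theory Num.Theory.
Local Open Scope ring_scope.

(** In a tree, twice the sum over the edges of the squared flow of [f] through
that edge is [- <f, D f>] when [f] has sum 0.  For the double star with centers
[a], [b] and leaf values [x_i], [y_j], writing [s = a + sum x_i] for the total
mass on the left, this reads
  [<f, D f> = - 2 (sum x_i^2 + sum y_j^2 + s^2)],       ([dist_form])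
which on the unit sphere equals [- 2 + 2 (a^2 + b^2 - s^2)].

The best constant [t] in [a^2 + b^2 - s^2 <= t <f, f>] remains to be found.  By
Cauchy-Schwarz ([sqr_sum_le]), for given [a], [b], [s] the norm of [f] is
smallest when [f] is constant on the leaves of each side, namely [(s - a) / m]
and [(- s - b) / n].  What is left is a quadratic form in [a], [b], [s]; with
[al = t (m + 1) - m] and [be = t (n + 1) - n], completing the squares in [a] and
[b] leaves [s^2 p(t) / (al be)], where [p] is the cubic ([complete_squares]).
So if [p(t) = 0], [al > 0] and [be > 0], the form is nonnegative and vanishes at
[s = 1], [a = t / al], [b = - t / be]: then [- 2 + 2 t] is the constant sought
([QEC_of_large_root]).

Such a root exists by the intermediate value theorem ([large_root_exists]).  It
is the largest root: any root with [al] and [be] positive yields the same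
maximum, hence equals [t], and a root with [al <= 0] or [be <= 0] lies below
[t] because [al] and [be] increase with [t]. *)

(** * Graph distance *)

(** Local criterion for a function to be the graph distance: it is 1-Lipschitz
in its first argument, so it bounds the length of every path from below, and
following its decrease step by step produces a walk that attains it. *)
Lemma dist_eq (G : cgraph) (d : G -> G -> nat) :
  (forall v w, (d v w == 0%N) = (v == w)) ->
  (forall u v w, adj u v -> (d u w <= (d v w).+1)%N) ->
  (forall u w k, d u w = k.+1 -> exists2 v, adj u v & d v w = k) ->
  forall v w, dist v w = d v w.
Proof.
move=> d0 dlip dstep v w.
have dle p u : path (@adj G) u p -> (d u (last u p) <= size p)%N.
  elim: p u => [|x p IHp] u /=; first by rewrite leqn0 d0.
  by case/andP=> ux /IHp le_p; apply: leq_trans (dlip _ _ _ ux) _; rewrite ltnS.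
have walk k u : d u w = k ->
    exists p, [/\ path (@adj G) u p, last u p = w & size p = k].
  elim: k u => [|k IHk] u duw.
    by move/eqP: duw; rewrite d0 => /eqP->; exists [::].
  have [x ux /IHk[p [xp lp sp]]] := dstep _ _ _ duw.
  by exists (x :: p); rewrite /= ux xp lp sp.
rewrite /dist; case: ex_minnP => k /existsP[p /and3P[vp /eqP lp _]] kmin.
apply/eqP; rewrite eqn_leq; apply/andP; split; last first.
  by rewrite -lp -[leqRHS](size_tuple p) dle.
have [q [vq lq sq]] := walk _ v erefl.
move: lq sq; case/shortenP: vq => r vr ur sub_r lr sq.
have le_rq : (size r <= size q)%N by apply: uniq_leq_size => //; case/andP: ur.
(* [r] is the walk [q] with its loops removed. *)
apply: leq_trans (_ : (size r <= _)%N); last by rewrite -sq.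
by apply: kmin; apply/existsP; exists (in_tuple r); rewrite vr ur lr eqxx.
Qed.

Section DoubleStarDistance.
Variables m n : nat.

Definition side (x : double_star m n) : bool :=
  match x with inl _ => false | inr _ => true end.

Definition leaf (x : double_star m n) : bool :=
  match x with inl i => i != ord0 | inr j => j != ord0 end.

Definition center (b : bool) : double_star m n :=
  if b then inr ord0 else inl ord0.

Lemma side_center b : side (center b) = b. Proof. by case: b. Qed.

Lemma leaf_center b : leaf (center b) = false.
Proof. by case: b. Qed.

Lemma eq_center x : ~~ leaf x -> x = center (side x).
Proof. by case: x => i /=; rewrite negbK => /eqP->. Qed.

Lemma adjE (x y : double_star m n) :
  adj x y = if side x == side y then leaf x != leaf y
            else ~~ leaf x && ~~ leaf y.
Proof.
case: x y => [i|i] [j|j] //=; rewrite /star_adj ?negbK //.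
all: by case: (i == ord0); case: (j == ord0).
Qed.

(** Each leaf contributes its pendant edge, and changing sides the central edge;
the formula only fails on the diagonal, where a leaf would be counted twice. *)
Lemma dist_double_star (x y : double_star m n) :
  dist x y =
    if x == y then 0%N else (leaf x + leaf y + (side x != side y))%N.
Proof.
move: x y; apply: dist_eq.
- move=> v w; case: (eqVneq v w) => // /eqP neq_vw; apply/negbTE/negP.
  rewrite !addn_eq0 => /andP[/andP[]]; rewrite !eqb0 => lv lw.
  rewrite negbK => /eqP svw; apply: neq_vw.
  by rewrite (eq_center lv) svw -eq_center.
- move=> u v w; rewrite adjE; case: (u =P w) => // _.
  case: (v =P w) => [->|_].
    by case: eqP; case: (leaf u); case: (leaf w).
  case: (side u); case: (side v); case: (side w);
    by case: (leaf u); case: (leaf v); case: (leaf w).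
- move=> u w k; case: eqP => // neq_uw duw.
  have [lu|lu] := boolP (leaf u).
    exists (center (side u)); first by rewrite adjE side_center leaf_center eqxx lu.
    move: duw; rewrite lu leaf_center side_center !add0n.
    case: (center _ =P w) => [<-|_ [] //].
    by rewrite leaf_center side_center eqxx => -[].
  have [suw|suw] := eqVneq (side u) (side w).
    have lw : leaf w.
      apply/negPn/negP => lw; apply: neq_uw.
      by rewrite (eq_center lu) suw -eq_center.
    move: duw; rewrite suw eqxx (negbTE lu) lw => -[<-].
    by exists w; rewrite ?eqxx // adjE suw eqxx (negbTE lu) lw.
  exists (center (side w)).
    by rewrite adjE side_center leaf_center (negbTE suw) lu.
  move: duw; rewrite suw (negbTE lu) leaf_center side_center eqxx !add0n addn0.
  case: (center _ =P w) => [<-|_]; first by rewrite leaf_center => -[].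
  by rewrite addn1 => -[].
Qed.

End DoubleStarDistance.

(** * Rayleigh quotients *)

Lemma is_QEC_unique (R : realType) (G : cgraph) (p q : R) :
  is_QEC G p -> is_QEC G q -> p = q.
Proof.
move=> [Sp ubp] [Sq ubq]; apply/eqP; rewrite eq_le.
by rewrite (ubp _ Sq) (ubq _ Sp).
Qed.

(** By homogeneity the maximum over the unit sphere is the best constant in
[<f, D f> <= q <f, f>], so an extremal [g] need not be normalized. *)
Lemma is_QEC_rayleigh (R : realType) (G : cgraph) (q : R) (g : G -> R) :
  (forall f : G -> R, inner (fun=> 1) f = 0 ->
     inner f (mx_app (@dist_mx R G) f) <= q * inner f f) ->
  inner (fun=> 1) g = 0 -> 0 < inner g g ->
  inner g (mx_app (@dist_mx R G) g) = q * inner g g ->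
  is_QEC G q.
Proof.
move=> le_q g0 g_gt0 gq.
split; last by move=> _ [f [f1 f0] <-]; rewrite -[leRHS]mulr1 -f1 le_q.
pose c := (Num.sqrt (inner g g))^-1; pose f v := c * g v.
have c2 : c ^+ 2 * inner g g = 1.
  by rewrite exprVn sqr_sqrtr ?ltW // mulVf // gt_eqF.
have ff : inner f f = c ^+ 2 * inner g g.
  by rewrite /inner mulr_sumr; apply: eq_bigr => v _; rewrite /f; ring.
have fDf : inner f (mx_app (@dist_mx R G) f) =
    c ^+ 2 * inner g (mx_app (@dist_mx R G) g).
  have Df v : mx_app (@dist_mx R G) f v = c * mx_app (@dist_mx R G) g v.
    by rewrite /mx_app mulr_sumr; apply: eq_bigr => w _; rewrite /f; ring.
  by rewrite /inner mulr_sumr; apply: eq_bigr => v _; rewrite Df /f; ring.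
exists f; last by rewrite fDf gq mulrCA c2 mulr1.
split; first by rewrite ff c2.
suff -> : inner (fun=> 1) f = c * inner (fun=> 1) g by rewrite g0 mulr0.
by rewrite /inner mulr_sumr; apply: eq_bigr => v _; rewrite /f; ring.
Qed.

(** * The distance form *)

Section Form.
Variables (R : realType) (m n : nat).
Implicit Type f : double_star m n -> R.

Lemma sum_double_star (F : double_star m n -> R) :
  \sum_x F x = (F (inl ord0) + \sum_(i < m) F (inl (lift ord0 i)))
             + (F (inr ord0) + \sum_(j < n) F (inr (lift ord0 j))).
Proof. by rewrite big_sumType /= !big_ord_recl. Qed.

(** On functions of sum 0, the terms of [dist_double_star] that depend on one
vertex only vanish.  The side term gives [2 s (- s)], the masses of the two sides
being opposite, and the correction on the diagonal gives the leaf squares. *)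
Lemma dist_form f : inner (fun=> 1) f = 0 ->
  inner f (mx_app (@dist_mx R (double_star m n)) f) =
    - 2 * (\sum_(i < m) f (inl (lift ord0 i)) ^+ 2
         + \sum_(j < n) f (inr (lift ord0 j)) ^+ 2
         + (f (inl ord0) + \sum_(i < m) f (inl (lift ord0 i))) ^+ 2).
Proof.
move=> f0.
have sf0 : \sum_x f x = 0.
  by rewrite -[RHS]f0; apply: eq_bigr => x _; rewrite mul1r.
set sl := f (inl ord0) + _.
have sr : f (inr ord0) + \sum_(j < n) f (inr (lift ord0 j)) = - sl.
  by move: sf0; rewrite sum_double_star -/sl => /eqP; rewrite addrC addr_eq0 => /eqP.
pose T := \sum_w (leaf w)%:R * f w.
have Df x : mx_app (@dist_mx R (double_star m n)) f x =
    T + (if side x then sl else - sl) - 2 * (leaf x)%:R * f x.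
  have dE y : dist_mx R x y * f y = (leaf x)%:R * f y + (leaf y)%:R * f y
      + (side x != side y)%:R * f y - 2 * (leaf x)%:R * ((x == y)%:R * f y).
    rewrite /dist_mx dist_double_star; case: eqP => [<-|_].
      by rewrite !eqxx mulr0n mulr1n; ring.
    by rewrite !natrD mulr0n; ring.
  rewrite /mx_app (eq_bigr _ (fun y _ => dE y)) !big_split /= sumrN.
  rewrite -!mulr_sumr sf0 mulr0 add0r -/T; congr (_ + _ - _ * _).
    rewrite sum_double_star /= -!mulr_sumr -!mulrDr sr -/sl.
    by case: (side x); rewrite /= mulr0n mulr1n; ring.
  rewrite (bigD1 x) //= eqxx mul1r big1 ?addr0 // => y /negbTE.
  by rewrite eq_sym => ->; rewrite mul0r.
have fDf x : f x * mx_app (@dist_mx R (double_star m n)) f x =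
    T * f x + (if side x then sl else - sl) * f x - 2 * ((leaf x)%:R * f x ^+ 2).
  by rewrite Df; ring.
rewrite /inner (eq_bigr _ (fun x _ => fDf x)) !big_split /= sumrN -!mulr_sumr sf0.
rewrite !sum_double_star /= -!mulr_sumr -!mulrDr sr -/sl.
rewrite !(eqxx, mulr0n, mulr1n).
ring.
Qed.

End Form.

(** Cauchy-Schwarz against the constant function 1, obtained from the positivity
of the sum of the squared deviations from the mean. *)
Lemma sqr_sum_le (R : realType) (k : nat) (x : 'I_k -> R) :
  (\sum_i x i) ^+ 2 <= k%:R * \sum_i x i ^+ 2.
Proof.
case: k x => [|k] x; first by rewrite big_ord0 expr0n mul0r.
set S := \sum_i x i.
have dev : \sum_i (k.+1%:R * x i - S) ^+ 2 =
    k.+1%:R * (k.+1%:R * (\sum_i x i ^+ 2) - S ^+ 2).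
  have dE i : (k.+1%:R * x i - S) ^+ 2 =
      k.+1%:R ^+ 2 * x i ^+ 2 - 2 * k.+1%:R * S * x i + S ^+ 2 by ring.
  rewrite (eq_bigr _ (fun i _ => dE i)) !big_split /= sumrN -!mulr_sumr -/S.
  by rewrite sumr_const card_ord -mulr_natl; ring.
rewrite -subr_ge0 -(pmulr_rge0 _ (_ : 0 < k.+1%:R)) ?ltr0n // -dev.
by apply: sumr_ge0 => i _; exact: sqr_ge0.
Qed.

Lemma sum_const_ord (R : realType) (k : nat) (c : R) :
  \sum_(i < k) c = k%:R * c.
Proof. by rewrite sumr_const card_ord mulr_natl. Qed.

(** * The cubic *)

Section Cubic.
Variables (R : realType) (m n : nat).
Hypotheses (hm : (1 <= m)%N) (hn : (1 <= n)%N).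
Local Notation p := (double_star_poly R m n).

Lemma horner_double_star_poly (t : R) :
  p.[t] = (m%:R + n%:R + 2) * t ^+ 3
    - (m%:R + n%:R + 1 - m%:R * n%:R) * t ^+ 2 - 2 * m%:R * n%:R * t + m%:R * n%:R.
Proof. by rewrite /double_star_poly !hornerE. Qed.

Let m_ge1 : 1 <= m%:R :> R. Proof. by rewrite ler1n. Qed.
Let n_ge1 : 1 <= n%:R :> R. Proof. by rewrite ler1n. Qed.
Let m_neq0 : m%:R != 0 :> R. Proof. by rewrite pnatr_eq0 -lt0n. Qed.
Let n_neq0 : n%:R != 0 :> R. Proof. by rewrite pnatr_eq0 -lt0n. Qed.

(** The determinant of the left-hand side, as a quadratic form in [a], [b], [s],
is [p.[t] / (m n)]; this is where the cubic comes from. *)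
Lemma complete_squares (t a b s : R) :
    t * (m%:R + 1) - m%:R != 0 -> t * (n%:R + 1) - n%:R != 0 ->
  t * (a ^+ 2 + b ^+ 2 + (s - a) ^+ 2 / m%:R + (s + b) ^+ 2 / n%:R)
      - (a ^+ 2 + b ^+ 2 - s ^+ 2) =
    (t * (m%:R + 1) - m%:R) / m%:R * (a - t * s / (t * (m%:R + 1) - m%:R)) ^+ 2
  + (t * (n%:R + 1) - n%:R) / n%:R * (b + t * s / (t * (n%:R + 1) - n%:R)) ^+ 2
  + s ^+ 2 * (p.[t] / ((t * (m%:R + 1) - m%:R) * (t * (n%:R + 1) - n%:R))).
Proof.
move=> a0 b0; rewrite horner_double_star_poly.
by field; rewrite a0 b0 m_neq0 n_neq0.
Qed.

(** Positivity of the two leading coefficients in [complete_squares] makes the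
form nonnegative at a root of the cubic, and the remaining degeneracy provides
the extremal function [g]. *)
Lemma QEC_of_large_root (t : R) :
    0 < t * (m%:R + 1) - m%:R -> 0 < t * (n%:R + 1) - n%:R ->
  root p t -> is_QEC (double_star m n) (- 2 + 2 * t).
Proof.
move=> al_gt0 be_gt0 /rootP pt0.
have t_gt0 : 0 < t.
  by rewrite -(pmulr_lgt0 t (_ : 0 < m%:R + 1)); move: m_ge1; lra.
set al := _ - m%:R in al_gt0; set be := _ - n%:R in be_gt0.
have csq a b s : t * (a ^+ 2 + b ^+ 2 + (s - a) ^+ 2 / m%:R + (s + b) ^+ 2 / n%:R)
      - (a ^+ 2 + b ^+ 2 - s ^+ 2) =
    al / m%:R * (a - t * s / al) ^+ 2 + be / n%:R * (b + t * s / be) ^+ 2.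
  by rewrite complete_squares ?gt_eqF // pt0 mul0r mulr0 addr0.
clearbody al be.
have sum1 (f : double_star m n -> R) : inner (fun=> 1) f =
    (f (inl ord0) + \sum_(i < m) f (inl (lift ord0 i)))
  + (f (inr ord0) + \sum_(j < n) f (inr (lift ord0 j))).
  by rewrite -sum_double_star; apply: eq_bigr => x _; rewrite mul1r.
have sum2 (f : double_star m n -> R) : inner f f =
    (f (inl ord0) ^+ 2 + \sum_(i < m) f (inl (lift ord0 i)) ^+ 2)
  + (f (inr ord0) ^+ 2 + \sum_(j < n) f (inr (lift ord0 j)) ^+ 2).
  exact: sum_double_star.
pose a := t / al; pose b := - t / be.
have eq_a : a - t * 1 / al = 0 by rewrite mulr1 subrr.
have eq_b : b + t * 1 / be = 0 by rewrite mulr1 /b mulNr addNr.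
have a_gt0 : 0 < a ^+ 2 by rewrite exprn_gt0 // divr_gt0.
clearbody a b.
pose g (x : double_star m n) : R := match x with
  | inl i => if i == ord0 then a else (1 - a) / m%:R
  | inr j => if j == ord0 then b else (- 1 - b) / n%:R
  end.
have g0 : inner (fun=> 1) g = 0.
  rewrite sum1 /= !sum_const_ord.
  by field; rewrite m_neq0 n_neq0.
have := csq a b 1; rewrite eq_a eq_b expr0n !mulr0 addr0 => kerE.
apply: (@is_QEC_rayleigh _ _ _ g) => //.
- move=> f f0; rewrite dist_form // sum2.
  move: f0; rewrite sum1.
  set a' := f (inl _); set b' := f (inr _).
  have := @sqr_sum_le R m (fun i => f (inl (lift ord0 i))).
  have := @sqr_sum_le R n (fun i => f (inr (lift ord0 i))).
  set X := \sum_(i < m) f _; set X2 := \sum_(i < m) f _ ^+ 2.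
  set Y := \sum_(i < n) f _; set Y2 := \sum_(i < n) f _ ^+ 2 => leY leX f0.
  have Xm : X ^+ 2 / m%:R <= X2 by rewrite ler_pdivrMr ?ltr0n // mulrC.
  have Yn : Y ^+ 2 / n%:R <= Y2 by rewrite ler_pdivrMr ?ltr0n // mulrC.
  (* [a' + X] is the mass of the left side, [s] in [csq]. *)
  have := csq a' b' (a' + X).
  have -> : a' + X - a' = X by ring.
  have -> : a' + X + b' = - Y by lra.
  rewrite sqrrN => csqE.
  have : 0 <= al / m%:R * (a' - t * (a' + X) / al) ^+ 2
            + be / n%:R * (b' + t * (a' + X) / be) ^+ 2.
    by rewrite addr_ge0 // mulr_ge0 ?sqr_ge0 // divr_ge0 ?ltW ?ltr0n.
  rewrite -csqE.
  have := ler_wpM2l (ltW t_gt0) Xm; have := ler_wpM2l (ltW t_gt0) Yn.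
  lra.
- rewrite sum2 /= !sum_const_ord.
  by rewrite -addrA ltr_wpDr // !addr_ge0 ?sqr_ge0 // mulr_ge0 ?ler0n ?sqr_ge0.
- rewrite (dist_form g0) sum2 /= !sum_const_ord.
  move: kerE.
  have -> : m%:R * ((1 - a) / m%:R) = 1 - a by field.
  have -> : m%:R * ((1 - a) / m%:R) ^+ 2 = (1 - a) ^+ 2 / m%:R by field.
  have -> : n%:R * ((- 1 - b) / n%:R) ^+ 2 = (1 + b) ^+ 2 / n%:R by field.
  have -> : a + (1 - a) = 1 by ring.
  lra.
Qed.

End Cubic.

Lemma double_star_polyC (R : realType) (m n : nat) :
  double_star_poly R m n = double_star_poly R n m.
Proof.
by rewrite /double_star_poly -!mulrA (mulrC n%:R m%:R) (addrC m%:R n%:R).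
Qed.

(** Put [al = t (m + 1) - m] and [be = t (n + 1) - n].  Then
[m n p = be h - m al t^2] with [h = al (m n + t (m + n)) - n t^2].  The quadratic
[h] changes sign on [1/2, 1]; at its root [u], [al] is positive, hence
[p(u) <= 0], while [p(1) = 1].  A root [t] of [p] in [u, 1] keeps [al > 0], and
[be > 0] follows if [n <= m], since [al > 0] means [t > m / (m + 1)].  Searching
beyond [u] matters when [m = n], where [m / (m + 1)] is itself a root of [p]. *)
Lemma large_root_exists (R : realType) (m n : nat) :
    (1 <= m)%N -> (1 <= n)%N ->
  exists t : R, [/\ 0 < t * (m%:R + 1) - m%:R, 0 < t * (n%:R + 1) - n%:R
                  & root (double_star_poly R m n) t].
Proof.
wlog le_nm : m n / (n <= m)%N.
  move=> wl hm hn; case: (leqP n m) => [|/ltnW] le; first exact: wl.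
  by have [t [? ? ?]] := wl _ _ le hn hm; exists t; rewrite double_star_polyC.
move=> hm hn.
have m_ge1 : 1 <= m%:R :> R by rewrite ler1n.
have n_ge1 : 1 <= n%:R :> R by rewrite ler1n.
have le_nmR : n%:R <= m%:R :> R by rewrite ler_nat.
move: (@horner_double_star_poly R m n).
move: (m%:R : R) (n%:R : R) m_ge1 n_ge1 le_nmR => x y x1 y1 le_yx pE.
pose h : {poly R} := ((x + 1) *: 'X - x%:P) * ((x + y) *: 'X + (x * y)%:P) - y *: 'X^2.
have hE t : h.[t] = (t * (x + 1) - x) * (x * y + t * (x + y)) - y * t ^+ 2.
  by rewrite /h !hornerE; ring.
have xy_gt0 : 0 < x * y by rewrite mulr_gt0 //; lra.
have [u /andP[u_ge u_le] /rootP hu] : exists2 u, 2^-1 <= u <= 1 & root h u.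
  apply: poly_ivt; first lra.
  have : 0 <= (x - 1) * (x * y + (x + y) / 2) by rewrite mulr_ge0 //; lra.
  by move=> *; rewrite !hE; apply/andP; split; lra.
rewrite hE in hu.
have al_gt0 : 0 < u * (x + 1) - x.
  have u_gt0 : 0 < u by lra.
  have w_gt0 : 0 < u * (x + y) by rewrite mulr_gt0 //; lra.
  rewrite -(pmulr_lgt0 _ (_ : 0 < x * y + u * (x + y))); last by lra.
  have -> : (u * (x + 1) - x) * (x * y + u * (x + y)) = y * u ^+ 2 by lra.
  by rewrite mulr_gt0 ?exprn_gt0 //; lra.
have pu : x * y * (double_star_poly R m n).[u] = - (x * (u * (x + 1) - x) * u ^+ 2).
  rewrite pE.
  have -> : x * y * ((x + y + 2) * u ^+ 3 - (x + y + 1 - x * y) * u ^+ 2 - 2 * x * y * u + x * y)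
   = (u * (y + 1) - y) * ((u * (x + 1) - x) * (x * y + u * (x + y)) - y * u ^+ 2)
     - (x * (u * (x + 1) - x) * u ^+ 2) by ring.
  by rewrite hu mulr0 add0r.
have [t /andP[t_ge t_le] rt] : exists2 t, u <= t <= 1 & root (double_star_poly R m n) t.
  apply: poly_ivt => //; apply/andP; split; last by rewrite pE; lra.
  rewrite -(pmulr_rle0 _ (_ : 0 < x * y)) ?pu //.
  by rewrite oppr_le0 !mulr_ge0 ?sqr_ge0 //; lra.
exists t; split=> //; nra.
Qed.

Theorem theorem3p6 (R : realType) (m n : nat) (hm : (1 <= m)%N) (hn : (1 <= n)%N) :
  exists t : R,
    is_largest_root (double_star_poly R m n) t /\
    is_QEC (double_star m n) (- 2 + 2 * t).
Proof.
have [t [al_gt0 be_gt0 rt]] := large_root_exists R hm hn.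
have Qt := QEC_of_large_root hm hn al_gt0 be_gt0 rt.
(* [s <= t] for any root [s]: by monotonicity of [al] and [be] if one of them is
   nonpositive at [s], and otherwise because [s] gives the same maximum. *)
exists t; split=> //; split=> // s rs.
have m_ge1 : 1 <= m%:R :> R by rewrite ler1n.
have n_ge1 : 1 <= n%:R :> R by rewrite ler1n.
have [als|als] := leP (s * (m%:R + 1) - m%:R) 0; first by nra.
have [bes|bes] := leP (s * (n%:R + 1) - n%:R) 0; first by nra.
have Qs := QEC_of_large_root hm hn als bes rs.
have := is_QEC_unique Qt Qs; lra.
Qed.
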